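(* Let $\phi_{\mathrm{xor}}$ be a conjunction of xor-constraints, $l_1,\dots,l_k$ literals, $G=\langle V,E,L\rangle$ a Subst-derivation on $\phi_{\mathrm{xor}}\land l_1\land\dots\land l_k$, and $W=(V_a,V_b)$ a cnf-compatible cut of $G$ (for some non-input vertex). Then there is a resolution derivation $\pi$ on $\bigwedge_{D\in\phi_{\mathrm{xor}}}\mathrm{cnf}(D)$ such that (i) for each vertex $v\in V_b$ with $L(v)\neq\top$, $\pi$ includes all the clauses in $\{\mathrm{expl}(v,W)\Rightarrow C : C\in\mathrm{cnf}(L(v))\}$, and (ii) $\pi$ has at most $|V|\,2^{m-1}$ clauses, where $m$ is the number of variables in the largest xor-constraint in $\phi_{\mathrm{xor}}$.
   Context: An xor-constraint is an equation $x_1\oplus\dots\oplus x_k\equiv p$ with Boolean variables $x_i$ and $p\in\{\bot,\top\}$; duplicate variables cancel in pairs; $\bot\equiv\bot$ is identified with $\top$, $\bot\equiv\top$ with $\bot$, $x\equiv\top$ with the literal $x$ and $x\equiv\bot$ with $\neg x$. $D[x/Y]$ denotes substitution of variable $x$ by $Y$ in $D$. $\mathrm{cnf}(D)$ is the straightforward CNF translation of $D$ (all clauses over $\mathrm{vars}(D)$ each excluding exactly one assignment falsifying $D$; $\mathrm{cnf}(\bot\equiv\top)$ is the empty clause). Subst rules, for variables $x,y$ and an xor-constraint $D$ containing $x$: from $x\equiv\top$ and $D$ infer $D[x/\top]$; from $x\equiv\bot$ and $D$ infer $D[x/\bot]$; from $x\oplus y\equiv\bot$ and $D$ infer $D[x/y]$;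 from $x\oplus y\equiv\top$ and $D$ infer $D[x/y\oplus\top]$. A Subst-derivation on a conjunction $\psi$ of xor-constraints is a vertex-labelled DAG $G=\langle V,E,L\rangle$ whose input vertices (no incoming edges) are labelled with xor-constraints of $\psi$ and each other vertex $v$ has exactly two incoming edges from $v',v''$ with $L(v)$ obtained from $L(v'),L(v'')$ by a Subst rule. Here $\psi=\phi_{\mathrm{xor}}\land l_1\land\dots\land l_k$, the $l_i$ being xor-assumptions. A cut for a non-input vertex $v$ is a partition $(V_a,V_b)$ of $V$ with $v\in V_b$ and such that every input vertex from which there is a path to $v$ lies in $V_a$. The cut is cnf-compatible if every vertex of $V_a$ having an edge to a vertex of $V_b$ is labelled either with an xor-constraint of $\phi_{\mathrm{xor}}$ or with a unary xor-constraint. The implicative explanation is $\mathrm{expl}(v,W)=f_W(v)$ where: (E1) if $u$ is an input vertex with $L(u)\in\phi_{\mathrm{xor}}$ then $f_W(u)=\top$; (E2) if $u$ is an input vertex with $L(u)\in\{l_1,\dots,l_k\}$ then $f_W(u)=L(u)$; (E3) if $u$ is a non-input vertex in $V_a$ then $f_W(u)=L(u)$; (E4) if $u$ is a non-input vertex in $V_b$ then $f_W(u)=f_W(u_1)\land f_W(u_2)$ where $u_1,u_2$ are the sources of the two edges entering $u$. For a conjunction of literals $\lambda=l'_1\land\dots\land l'_r$ and a clause $C$, $\lambda\Rightarrow C$ denotes the clause $\neg l'_1\lor\dots\lor\neg l'_r\lor C$. A resolution derivation on a CNF formula is a sequence of clauses each being a clause of the formula or a resolvent of two earlier clauses.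
   Formalization: (i) is claimed only when expl(v,W) is a conjunction of literals, and not for tautological clauses at input or ⊥ vertices; (ii) allows one extra clause if m=2 and V_b has a ⊥ vertex with two binary sources; a resolvent of x∨A, ¬x∨B is A∨B, where A may contain x and B may contain ¬x. *)

(* Defs.v *)
From mathcomp Require Import all_boot finmap.

Set Implicit Arguments.
Unset Strict Implicit.
Unset Printing Implicit Defensive.

Local Open Scope fset_scope.

(* Propositional side: the literal (x, true) is x, (x, false) is ~ x. *)

Definition literal (X : choiceType) : choiceType := (X * bool)%type.

Definition neg (X : choiceType) (l : literal X) : literal X := (l.1, ~~ l.2).

Definition clause (X : choiceType) : choiceType := {fset literal X}.

Definition tautological (X : choiceType) (C : clause X) : Prop :=
  exists l : literal X, l \in C /\ neg l \in C.

(* lam => C, for a conjunction of literals given as the finite set lam. *)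
Definition implies_clause (X : choiceType) (lam : {fset literal X})
    (C : clause X) : clause X :=
  [fset neg l | l in lam] `|` C.

(* The rule "from x \/ A and ~ x \/ B infer A \/ B", where disjunctions are
   idempotent: A may itself contain x, and B may contain ~ x. *)
Definition resolvent (X : choiceType) (C1 C2 C : clause X) : Prop :=
  exists (x : X) (A B : clause X),
    [/\ C1 = (x, true) |` A, C2 = (x, false) |` B & C = A `|` B].

Definition resolution_derivation (X : choiceType) (F : clause X -> Prop)
    (pi : seq (clause X)) : Prop :=
  forall i, i < size pi ->
    F (nth fset0 pi i) \/
    exists j k, [/\ j < i, k < i &
      resolvent (nth fset0 pi j) (nth fset0 pi k) (nth fset0 pi i)].

(* x1 (+) ... (+) xk = p with duplicate variables cancelled is the pair of the
   set {x1, ..., xk} and of p; so (fset0, false) is T and (fset0, true) is _|_. *)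
Definition xorc (X : choiceType) : choiceType := ({fset X} * bool)%type.

Definition xvars (X : choiceType) (D : xorc X) : {fset X} := D.1.
Definition xparity (X : choiceType) (D : xorc X) : bool := D.2.

Definition xtop (X : choiceType) : xorc X := (fset0, false).
Definition xbot (X : choiceType) : xorc X := (fset0, true).

Definition lit_xor (X : choiceType) (l : literal X) : xorc X :=
  ([fset l.1], l.2).

Definition xarity (X : choiceType) (D : xorc X) : nat := #|` xvars D|.

(* The clause over vars(D) that excludes exactly the assignment whose set of
   true variables is T. *)
Definition excluding_clause (X : choiceType) (D : xorc X) (T : {fset X}) :
    clause X :=
  [fset ((x, x \notin T) : literal X) | x in xvars D].

(* An assignment falsifies D iff the parity of the number of variables it makes
   true differs from the parity of D. *)
Definition cnf (X : choiceType) (D : xorc X) : {fset clause X} :=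
  [fset excluding_clause D T
    | T in fpowerset (xvars D) & odd #|` T| != xparity D].

(* For D containing x, D[x / y1 (+) ... (+) yr (+) c], with Y = {y1, ..., yr}:
   variables common to Y and the rest of D cancel, the constant c moves to the
   right-hand side. *)
Definition xsubst (X : choiceType) (D : xorc X) (x : X) (Y : {fset X})
    (c : bool) : xorc X :=
  let S := xvars D `\ x in
  ((S `\` Y) `|` (Y `\` S), xparity D (+) c).

Inductive subst_rule (X : choiceType) : xorc X -> xorc X -> xorc X -> Prop :=
| subst_top x D : x \in xvars D ->
    subst_rule ([fset x], true) D (xsubst D x fset0 true)
| subst_bot x D : x \in xvars D ->
    subst_rule ([fset x], false) D (xsubst D x fset0 false)
| subst_eq x y D : x != y -> x \in xvars D ->
    subst_rule ([fset x; y], false) D (xsubst D x [fset y] false)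
| subst_neq x y D : x != y -> x \in xvars D ->
    subst_rule ([fset x; y], true) D (xsubst D x [fset y] true).

Definition is_input (V : finType) (E : rel V) (v : V) : bool :=
  [forall u, ~~ E u v].

Definition acyclic (V : finType) (E : rel V) : Prop :=
  forall u v, E u v -> ~~ connect E v u.

Record subst_derivation (X : choiceType) (V : finType) (E : rel V)
    (L : V -> xorc X) (psi : seq (xorc X)) : Prop := SubstDerivation {
  sd_acyclic : acyclic E;
  sd_input : forall v, is_input E v -> L v \in psi;
  sd_rule : forall v, ~~ is_input E v ->
    exists v1 v2, [/\ v1 != v2,
      forall u, E u v = (u == v1) || (u == v2) &
      subst_rule (L v1) (L v2) (L v)] }.

Definition is_cut (V : finType) (E : rel V) (v : V) (Va Vb : {set V}) : Prop :=
  [/\ Vb = (~: Va)%SET, v \in Vb &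
      forall u, is_input E u -> connect E u v -> u \in Va].

Definition cnf_compatible (X : choiceType) (V : finType) (E : rel V)
    (L : V -> xorc X) (phi : seq (xorc X)) (Va Vb : {set V}) : Prop :=
  forall u w, u \in Va -> w \in Vb -> E u w ->
    L u \in phi \/ xarity (L u) = 1.

(* A conjunction of xor-constraints is represented by the set of its conjuncts,
   the empty set being T. The label of an input vertex that is not in phi is an
   xor-assumption. *)
Fixpoint expl_rec (X : choiceType) (V : finType) (E : rel V)
    (L : V -> xorc X) (phi : seq (xorc X)) (Va : {set V}) (n : nat) (u : V) :
    {fset xorc X} :=
  if n is n'.+1 then
    if is_input E u then (if L u \in phi then fset0 else [fset L u])
    else if u \in Va then [fset L u]
    else \bigcup_(w | E w u) expl_rec E L phi Va n' w
  else fset0.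

(* On an acyclic graph #|V| unfoldings suffice, as explE confirms. *)
Definition expl (X : choiceType) (V : finType) (E : rel V)
    (L : V -> xorc X) (phi : seq (xorc X)) (Va : {set V}) (u : V) :
    {fset xorc X} :=
  expl_rec E L phi Va #|V| u.

Lemma expl_rec_stable (X : choiceType) (V : finType) (E : rel V)
    (L : V -> xorc X) (phi : seq (xorc X)) (Va : {set V}) :
  acyclic E -> forall n m u,
  #|[set w | connect E w u]| <= n -> #|[set w | connect E w u]| <= m ->
  expl_rec E L phi Va n u = expl_rec E L phi Va m u.
Proof.
move=> acE.
have pos u : 0 < #|[set w | connect E w u]|.
  by apply/card_gt0P; exists u; rewrite inE connect0.
have dec w u : E w u ->
    #|[set x | connect E x w]| < #|[set x | connect E x u]|.
  move=> Ewu; apply/proper_card/properP; split.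
    apply/subsetP=> x; rewrite !inE => xw.
    exact: connect_trans xw (connect1 Ewu).
  by exists u; rewrite inE ?connect0 // acE.
elim=> [|n IHn] [|m] u; rewrite ?leqn0 ?(gtn_eqF (pos u)) //= => le_n le_m.
case: ifP => // _; case: ifP => // _; apply: eq_bigr => w Ewu.
apply: IHn; rewrite -ltnS; apply: leq_trans (dec _ _ Ewu) _ => //.
Qed.

Lemma explE (X : choiceType) (V : finType) (E : rel V)
    (L : V -> xorc X) (phi : seq (xorc X)) (Va : {set V}) (u : V) :
  acyclic E ->
  expl E L phi Va u =
    if is_input E u then (if L u \in phi then fset0 else [fset L u])
    else if u \in Va then [fset L u]
    else \bigcup_(w | E w u) expl E L phi Va w.
Proof.
move=> acE; rewrite /expl.
have -> : expl_rec E L phi Va #|V| u = expl_rec E L phi Va #|V|.+1 u.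
  by apply: expl_rec_stable => //; rewrite ?leqW // max_card.
by [].
Qed.

(* Two two-variable constraints on the same pair of variables that contradict
   each other. *)
Definition binary_conflict (X : choiceType) (V : finType) (E : rel V)
    (L : V -> xorc X) (v : V) : bool :=
  [&& ~~ is_input E v, L v == xbot X &
      [forall u, E u v ==> (xarity (L u) == 2)]].

(* Main.v *)
Require Import Defs.
From mathcomp Require Import all_boot finmap zify.

(* The derivation is built along the graph, sources first.  Let N(u) be the set
   of the negations of the literals of expl(u), so that the clauses required at
   u are N(u) \/ C with C in cnf(L(u)).  If u is an assumption, or lies in V_a
   and is explained by its own label, these are tautologies l \/ ~ l, and
   resolving against one has no effect; all other clauses are obtained from
   those of the two sources.  Substituting for x in D a constant, or a variable
   y not in D, takes one resolution step on x per clause.  If y is in D, both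
   variables disappear and each clause C costs three: N \/ C \/ y, N \/ C \/ ~ y
   and N \/ C.  But at least two variables fewer than m remain, so at most
   2 ^ (m - 1) clauses are still added, except for the contradiction when m = 2.
   In that case no assumption is involved, the clause is the empty one, and it
   has to be derived only once. *)

Set Implicit Arguments.
Unset Strict Implicit.
Unset Printing Implicit Defensive.

Local Open Scope fset_scope.

(** * Extending resolution derivations *)

Section Resolution.
Variable X : choiceType.
Implicit Types (F : clause X -> Prop) (pi cs : seq (clause X)).

(** The disjunct [C \in pi] permits repetitions; they occur when the other premise of a resolution
    step would be a tautology. *)
Definition derives F pi (C : clause X) : Prop :=
  [\/ C \in pi, F C |
      exists P Q, [/\ P \in pi, Q \in pi & resolvent P Q C]].

Lemma resolution_derivation_rcons F pi C :
  resolution_derivation F pi -> derives F pi C ->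
  resolution_derivation F (rcons pi C).
Proof.
move=> dpi dC i; rewrite size_rcons ltnS leq_eqVlt => /orP [/eqP -> | lti].
  have nthl k : k < size pi -> nth fset0 (rcons pi C) k = nth fset0 pi k.
    by move=> ltk; rewrite nth_rcons ltk.
  rewrite nth_rcons ltnn eqxx; case: dC => [Cpi|FC|[P [Q [Ppi Qpi res]]]].
  (* A repeated clause inherits the justification of its first occurrence. *)
  - have := Cpi; rewrite -index_mem => ltC.
    case: (dpi _ ltC); rewrite nth_index //; first by left.
    move=> [j [k [ltj ltk res]]]; right; exists j, k.
    have ltj' := ltn_trans ltj ltC; have ltk' := ltn_trans ltk ltC.
    by rewrite !nthl.
  - by left.
  - right; exists (index P pi), (index Q pi).
    by rewrite !nthl ?index_mem // !nth_index.
case: (dpi i lti) => [Fi|[j [k [ltj ltk res]]]]; rewrite nth_rcons lti.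
  by left.
right; exists j, k.
by rewrite !nth_rcons (ltn_trans ltj lti) (ltn_trans ltk lti).
Qed.

Lemma derives_sub F pi pi' C :
  {subset pi <= pi'} -> derives F pi C -> derives F pi' C.
Proof.
move=> sub [/sub Cpi|FC|[P [Q [/sub Ppi /sub Qpi res]]]].
- exact: Or31.
- exact: Or32.
- by apply: Or33; exists P, Q.
Qed.

Lemma resolution_derivation_cat F pi cs :
  resolution_derivation F pi -> {in cs, forall C, derives F pi C} ->
  resolution_derivation F (pi ++ cs).
Proof.
elim: cs pi => [|C cs IH] pi dpi dcs; first by rewrite cats0.
rewrite -cat_rcons; apply: IH.
  by apply: resolution_derivation_rcons => //; apply: dcs; rewrite mem_head.
move=> B Bcs; apply: (@derives_sub _ pi).
  by move=> A Api; rewrite mem_rcons inE Api orbT.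
by apply: dcs; rewrite inE Bcs orbT.
Qed.

(** [resolvent] wants the positive pivot in its first premise; this form is symmetric in the
    polarity, the premises being swapped when [b] is false. *)
Lemma derives_resolvent F pi x b (A B : clause X) :
  (x, b) |` A \in pi -> (x, ~~ b) |` B \in pi -> derives F pi (A `|` B).
Proof.
case: b => Api Bpi; apply: Or33.
  by exists ((x, true) |` A), ((x, false) |` B); split=> //; exists x, A, B.
exists ((x, true) |` B), ((x, false) |` A); split=> //.
by exists x, B, A; split=> //; rewrite fsetUC.
Qed.

End Resolution.

(** * Clauses of an xor-constraint: adding or splitting off a variable, and counting *)

Section Cnf.
Variable X : choiceType.
Implicit Types (S T : {fset X}) (C : clause X) (D : xorc X).

Lemma cnfP D C :
  reflect (exists T, [/\ T `<=` D.1, odd #|` T| = ~~ D.2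
                       & C = excluding_clause D T])
          (C \in cnf D).
Proof.
rewrite /cnf; apply: (iffP (imfsetP _ _ _ _)) => [[T /=]|[T [sTD pT ->]]].
  rewrite !inE fpowersetE => /andP [sTD pT] ->; exists T; split=> //.
  by move: pT; rewrite /xparity; case: (odd _) D.2 => -[].
by exists T => //=; rewrite !inE fpowersetE sTD pT /xparity; case: D.2.
Qed.

Lemma in_excluding D T z b :
  ((z, b) \in excluding_clause D T) = (z \in D.1) && (b == (z \notin T)).
Proof.
apply/imfsetP/andP => [[x /= xD [-> ->]]|[zD /eqP ->]]; first by rewrite eqxx.
by exists z.
Qed.

(** The literal [(x, ~~ b)] excludes [x = b]; giving [x] the value [b] in the excluded assignment
    flips its parity exactly when [b] holds. *)
Lemma cnf_add x b S q C :
  x \notin S -> C \in cnf (S, q) -> (x, ~~ b) |` C \in cnf (x |` S, q (+) b).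
Proof.
move=> xS /cnfP [T [/= sTS pT ->]].
have xT : x \notin T by apply: contra xS; apply: (fsubsetP sTS).
apply/cnfP; exists (if b then x |` T else T); split=> /=.
- case: b; first exact: fsetUS.
  exact: fsubset_trans sTS (fsubsetUr _ _).
- case: b; rewrite ?cardfsU1 ?xT /= pT; by case: q {pT}.
apply/fsetP => -[z c]; rewrite in_fset1U !in_excluding /= in_fset1U xpair_eqE.
case: (eqVneq z x) => [->|nzx] /=.
  rewrite (negbTE xS) orbF; case: b => /=; last by rewrite xT.
  by rewrite fset1U1.
by case: b; rewrite // in_fset1U (negbTE nzx).
Qed.

Lemma cnf_split x S q C :
  x \notin S -> C \in cnf (x |` S, q) ->
  exists b, exists2 B, C = (x, ~~ b) |` B & B \in cnf (S, q (+) b).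
Proof.
move=> xS /cnfP [T [/= sTS pT ->]].
exists (x \in T), (excluding_clause (S, q) T).
  apply/fsetP => -[z c]; rewrite in_fset1U !in_excluding /= in_fset1U xpair_eqE.
  case: (eqVneq z x) => [->|//] /=.
  by rewrite (negbTE xS) orbF.
apply/cnfP; exists (T `\ x); split=> /=.
- by rewrite fsubDset.
- have := pT; rewrite (cardfsD1 x T) oddD; case: (x \in T) q {pT} => -[] /=;
  by case: (odd _).
apply/fsetP => -[z c]; rewrite !in_excluding /= in_fsetD1.
by case: (eqVneq z x) => [->|//]; rewrite (negbTE xS).
Qed.

Lemma cnf0 q : cnf (fset0 : {fset X}, q) = if q then [fset fset0] else fset0.
Proof.
apply/fsetP => C; apply/cnfP/idP => [[T [/=]]|].
  rewrite fsubset0 => /eqP ->; rewrite cardfs0; case: q => //= _ ->.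
  rewrite inE; apply/eqP/fsetP => -[z c].
  by rewrite in_excluding /= !in_fset0.
case: q => //; rewrite inE => /eqP ->; exists fset0.
split; [exact: fsub0set|by rewrite cardfs0|].
by apply/fsetP => -[z c]; rewrite in_excluding /= !in_fset0.
Qed.

Lemma cnf1 (x : X) b :
  cnf ([fset x], b) = [fset [fset (x, b)]] :> {fset clause X}.
Proof.
have e : [fset x] = x |` fset0 :> {fset X} by rewrite fsetU0.
apply/fsetP => C; rewrite in_fset1; apply/idP/eqP => [|->].
  rewrite e => /cnf_split [|c [B ->]]; first by rewrite inE.
  by rewrite cnf0; case: b c => -[] //=; rewrite inE => /eqP ->; rewrite fsetU0.
have : (x, ~~ ~~ b) |` fset0 \in cnf (x |` fset0, true (+) ~~ b).
  by apply: cnf_add; rewrite ?cnf0 ?inE.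
by rewrite !fsetU0 addTb !negbK.
Qed.

(** Clause form of the implication from [y = b] to [x = b (+) p]. *)
Lemma cnf2 (x y : X) b p :
  x != y -> (x, b (+) p) |` [fset (y, ~~ b)] \in cnf ([fset x; y], p).
Proof.
move=> nxy; have := @cnf_add x (~~ (b (+) p)) [fset y] (~~ b) [fset (y, ~~ b)].
rewrite negbK inE cnf1 inE eqxx => /(_ nxy isT).
by have -> : ~~ b (+) ~~ (b (+) p) = p by case: b p => -[].
Qed.

(** The sign of [x] in a clause decides which parity on [S] the rest of the clause belongs to. *)
Lemma card_cnf_fset1U x S q : x \notin S ->
  #|` cnf (x |` S, q)| <= #|` cnf (S, true)| + #|` cnf (S, false)|.
Proof.
move=> xS.
have sub : cnf (x |` S, q) `<=`
    [fset (x, q) |` B | B in cnf (S, true)]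
    `|` [fset (x, ~~ q) |` B | B in cnf (S, false)].
  apply/fsubsetP => C /(cnf_split xS) [b [B -> BS]]; rewrite inE.
  case e: (q (+) b) BS => BS; apply/orP; [left|right];
    by apply/imfsetP; exists B => //; case: q b e => -[].
apply: leq_trans (fsubset_leq_card sub) _.
rewrite cardfsU; apply: leq_trans (leq_subr _ _) _.
by apply: leq_add; apply: leq_imfset_card.
Qed.

Lemma card_cnf_parities S :
  #|` cnf (S, true)| + #|` cnf (S, false)| <= 2 ^ #|` S|.
Proof.
elim/fset1U_rect: S => [|x S xS IH].
  by rewrite !cnf0 cardfs1 !cardfs0.
rewrite cardfsU1 xS expnS mul2n -addnn.
by apply: leq_add; apply: leq_trans (card_cnf_fset1U _ xS) IH.
Qed.

(** Splitting off one variable leaves both parities of the rest, and an assignment falsifies only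
    one of them. Without variables the exponent truncates to [0], and the bound [1] accommodates
    [xbot]. *)
Lemma card_cnf D : #|` cnf D| <= 2 ^ (xarity D).-1.
Proof.
case: D => S q; rewrite /xarity /=.
elim/fset1U_rect: S q => [|x S xS _] q.
  by rewrite cnf0 cardfs0; case: q; rewrite ?cardfs1 ?cardfs0.
rewrite cardfsU1 xS add1n /=; apply: leq_trans (card_cnf_parities S).
exact: card_cnf_fset1U.
Qed.

End Cnf.

(** * Simulating one substitution step by resolution *)

Section Substitution.
Variable X : choiceType.
Implicit Types (F : clause X -> Prop) (pi cs : seq (clause X)).
Implicit Types (N C : clause X) (D : xorc X) (S : {fset X}) (l : literal X).

(** The four rules regrouped by what cancels, with the eliminated variables split off from the
    common part [S]; each case has its own resolution pattern. *)
Variant subst_spec : xorc X -> xorc X -> xorc X -> Prop :=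
| SubstUnit x b S q of x \notin S :
    subst_spec ([fset x], b) (x |` S, q) (S, q (+) b)
| SubstFresh x y p S q of x != y & x \notin S & y \notin S :
    subst_spec ([fset x; y], p) (x |` S, q) (y |` S, q (+) p)
| SubstShared x y p S q of x != y & x \notin S & y \notin S :
    subst_spec ([fset x; y], p) (x |` (y |` S), q) (S, q (+) p).

Lemma subst_ruleP D1 D2 D : subst_rule D1 D2 D -> subst_spec D1 D2 D.
Proof.
have unit x b S q : x \in S ->
    subst_spec ([fset x], b) (S, q) (xsubst (S, q) x fset0 b).
  move=> xS; rewrite -{1}(fsetD1K xS) /xsubst /= fsetD0 fset0D fsetU0.
  by apply: SubstUnit; rewrite !inE eqxx.
have bin x y p S q : x != y -> x \in S ->
    subst_spec ([fset x; y], p) (S, q) (xsubst (S, q) x [fset y] p).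
  move=> nxy xS; have xSx : x \notin S `\ x by rewrite !inE eqxx.
  rewrite -{1}(fsetD1K xS) /xsubst /=.
  have [yS|yS] := boolP (y \in S `\ x).
    have -> : [fset y] `\` (S `\ x) = fset0.
      by apply/eqP; rewrite fsetD_eq0 fsub1set.
    rewrite fsetU0 -{1}(fsetD1K yS); apply: SubstShared => //.
      by rewrite inE negb_and xSx orbT.
    by rewrite !inE eqxx.
  have -> : [fset y] `\` (S `\ x) = [fset y].
    by apply/fsetDidPl; rewrite fdisjoint1X.
  have -> : (S `\ x) `\` [fset y] = S `\ x.
    by apply/fsetDidPl; rewrite fdisjointX1.
  by rewrite [_ `\ _ `|` _]fsetUC; apply: SubstFresh.
by case=> [x [S q]|x [S q]|x y [S q]|x y [S q]] *; auto.
Qed.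

Lemma xarity_subst D1 D2 D : subst_spec D1 D2 D ->
  xarity D <= xarity D2.
Proof.
rewrite /xarity; case=> [x b S q xS|x y p S q nxy xS yS|x y p S q nxy xS yS] /=.
- by rewrite cardfsU1 xS.
- by rewrite !cardfsU1 xS yS.
- by rewrite !cardfsU1 yS inE; lia.
Qed.

Lemma xarity_sources D1 D2 D : subst_spec D1 D2 D ->
  0 < xarity D1 /\ 0 < xarity D2.
Proof.
by case=> [x b S q _|x y p S q _ _ _|x y p S q _ _ _];
  rewrite /xarity /= !cardfs_gt0; split; apply/fset0Pn; exists x;
  rewrite !inE ?eqxx.
Qed.

(** In the second case the only clause would be the tautology made of [l] and [neg l]. It need not
    be derivable, so it is left implicit. *)
Definition available pi N D : Prop :=
  (forall C, C \in cnf D -> N `|` C \in pi) \/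
  (exists2 l, D = lit_xor l & N = [fset neg l]).

Local Ltac fset_tauto :=
  apply/fsetP => ?; rewrite !inE;
  repeat first [case: (_ \in _) | case: (_ == _)]; done.

Lemma lit_xor_fset1U x S q l :
  x \notin S -> (x |` S, q) = lit_xor l -> S = fset0 /\ l = (x, q).
Proof.
case: l => z b xS [/fsetP eS ->].
have /eqP ez : x == z by rewrite -in_fset1 -eS fset1U1.
split; last by rewrite ez.
apply/fsetP => y; rewrite inE; apply/negP => yS.
have := eS y; rewrite !inE yS orbT -ez => /esym /eqP eyx.
by rewrite -eyx yS in xS.
Qed.

Lemma lit_xor_fset2 (x y : X) p l : x != y -> ([fset x; y], p) <> lit_xor l.
Proof.
move=> nxy /(congr1 (fun D => #|` D.1|)).
by rewrite /= cardfs2 nxy cardfs1.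
Qed.

(** The exception occurs when both premises are implicit: they are opposite literals on [x], so the
    explanation is contradictory and there is nothing to resolve. *)
Lemma derives_unit F pi N1 N2 x b S q C :
  x \notin S -> available pi N1 ([fset x], b) -> available pi N2 (x |` S, q) ->
  C \in cnf (S, q (+) b) ->
  derives F pi (N1 `|` N2 `|` C) \/
  ((S, q (+) b) = xbot X /\ tautological (N1 `|` N2 `|` C)).
Proof.
move=> xS av1 av2 CS; have := cnf_add b xS CS; rewrite addbK => Q.
have P : [fset (x, b)] \in cnf ([fset x], b) by rewrite cnf1 inE.
case: av2 => [/(_ _ Q) {}Q|[l2 /(lit_xor_fset1U xS) [S0 ->] /= ->]].
  case: av1 => [/(_ _ P) {}P|[[z c] [/fset1_inj <- <-] /= ->]].
    left; have -> : N1 `|` N2 `|` C = N1 `|` (N2 `|` C) by rewrite fsetUA.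
    apply: (@derives_resolvent _ _ _ x b); first by rewrite fsetUC.
    by rewrite fsetUCA.
  (* Here [N1] is just the literal on [x] in the clause coming from the second premise, so the goal
     is that clause itself. *)
  by left; apply: Or31; rewrite -fsetUA fsetUCA.
move: CS; rewrite {}S0 cnf0; case eqb : (q (+) b); rewrite inE // => /eqP ->.
case: av1 => [/(_ _ P) {}P|[[z c] [/fset1_inj <- <-] /= ->]].
  left; apply: Or31; rewrite fsetU0 /neg /=.
  by have -> : ~~ q = b by clear - eqb; case: q b eqb => -[].
right; split=> //; exists (x, b); rewrite /neg /= !inE.
by have -> : ~~ q = b; [clear - eqb; case: q b eqb => -[]|rewrite !eqxx !orbT].
Qed.

(** The value [c] of [y] excluded by [C] determines both premises: the binary constraint sends
    [y = c] to [x = c (+) p], and the other clause excludes that value of [x]. A binary constraint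
    is never implicit, so no exception arises. *)
Lemma derives_fresh F pi N1 N2 x y p S q C :
  x != y -> x \notin S -> y \notin S ->
  available pi N1 ([fset x; y], p) -> available pi N2 (x |` S, q) ->
  C \in cnf (y |` S, q (+) p) -> derives F pi (N1 `|` N2 `|` C).
Proof.
move=> nxy xS yS [av1|[l /lit_xor_fset2 []//]] av2.
move=> /(cnf_split yS) [c [B -> BS]].
have P := av1 _ (cnf2 c p nxy).
have := cnf_add (c (+) p) xS BS.
have -> : q (+) p (+) c (+) (c (+) p) = q by clear; case: q p c => -[] [].
move=> Q; case: av2 => [/(_ _ Q) {}Q|[l2 /(lit_xor_fset1U xS) [S0 ->] /= ->]].
  have -> : N1 `|` N2 `|` ((y, ~~ c) |` B)
      = (N1 `|` [fset (y, ~~ c)]) `|` (N2 `|` B) by fset_tauto.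
  apply: (@derives_resolvent _ _ _ x (c (+) p)); first by rewrite fsetUCA.
  by rewrite fsetUCA.
(* The second constraint is now a literal on [x], and [N2] is the pivot literal of the first clause;
   the goal is that clause. *)
apply: Or31; move: BS; rewrite S0 cnf0.
case e: (q (+) p (+) c); rewrite inE // => /eqP ->.
have eq : ~~ q = c (+) p by clear - e; case: q p c e => -[] [].
rewrite /neg /= eq; congr (_ \in pi): P; fset_tauto.
Qed.

(** If [y] has the value [~~ c], the binary constraint forces [x = ~~ c (+) p]; extending [C] by the
    literals excluding these two values gives a clause of the larger constraint. Only [x] is
    eliminated here, and [y] remains with either sign. *)
Lemma derives_shared F pi N1 N2 x y p S q c C :
  x != y -> x \notin S -> y \notin S ->
  available pi N1 ([fset x; y], p) -> available pi N2 (x |` (y |` S), q) ->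
  C \in cnf (S, q (+) p) ->
  derives F pi ((y, c) |` (N1 `|` N2 `|` C)).
Proof.
move=> nxy xS yS [av1|[l /lit_xor_fset2 []//]] av2 CS.
have xyS : x \notin y |` S by rewrite !inE negb_or nxy.
have {}av2 : forall C, C \in cnf (x |` (y |` S), q) -> N2 `|` C \in pi.
  case: av2 => // -[l /(lit_xor_fset1U xyS) [/fsetP /(_ y)]].
  by rewrite fset1U1 inE.
have P := av1 _ (cnf2 (~~ c) p nxy).
have := cnf_add (~~ c (+) p) xyS (cnf_add (~~ c) yS CS).
have -> : q (+) p (+) ~~ c (+) (~~ c (+) p) = q.
  by clear; case: q p c => -[] [].
move=> /av2; move: P; rewrite negbK => P Q.
have -> : (y, c) |` (N1 `|` N2 `|` C)
    = (N1 `|` [fset (y, c)]) `|` (N2 `|` ((y, c) |` C)) by fset_tauto.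
apply: (@derives_resolvent _ _ _ x (~~ c (+) p)); first by rewrite fsetUCA.
by rewrite fsetUCA.
Qed.

(** The alternative in the hypothesis is not decidable, so the clauses to append are chosen by
    induction rather than by a filter. *)
Lemma select_derivable (T : eqType) F pi (f : T -> clause X) (P : T -> Prop) s :
  (forall t, t \in s -> derives F pi (f t) \/ P t) ->
  exists cs, [/\ size cs <= size s, {in cs, forall C, derives F pi C} &
                 forall t, t \in s -> f t \in cs \/ P t].
Proof.
elim: s => [|a s IH] H; first by exists [::].
have [t ts|cs [lecs dcs mcs]] := IH.
  by apply: H; rewrite inE ts orbT.
case: (H a (mem_head _ _)) => [da|Pa].
  exists (f a :: cs); split=> //.
    by move=> C; rewrite inE => /orP [/eqP -> //|/dcs].
  move=> t; rewrite inE => /orP [/eqP ->|/mcs [ft|Pt]]; last by right.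
    by left; rewrite mem_head.
  by left; rewrite inE ft orbT.
exists cs; split=> //; first exact: leqW.
by move=> t; rewrite inE => /orP [/eqP ->|/mcs]; first by right.
Qed.

Lemma extend_derivation F pi N1 N2 D1 D2 D m :
  resolution_derivation F pi -> available pi N1 D1 -> available pi N2 D2 ->
  subst_spec D1 D2 D -> 0 < m -> xarity D2 <= m ->
  exists cs,
    [/\ resolution_derivation F (pi ++ cs),
        forall C, C \in cnf D -> N1 `|` N2 `|` C \in pi ++ cs \/
          (D = xbot X /\ tautological (N1 `|` N2 `|` C)) &
        2 * size cs <= 2 ^ m \/
        [/\ m = 2, xarity D1 = 2, xarity D2 = 2, D = xbot X & size cs = 3]].
Proof.
move=> dpi av1 av2 sub m0 D2m; have Dm := leq_trans (xarity_subst sub) D2m.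
have e2m : 2 ^ m = 2 * 2 ^ m.-1 by rewrite -expnS prednK.
have simple : (forall C, C \in cnf D -> derives F pi (N1 `|` N2 `|` C) \/
                (D = xbot X /\ tautological (N1 `|` N2 `|` C))) ->
  exists cs,
    [/\ resolution_derivation F (pi ++ cs),
        forall C, C \in cnf D -> N1 `|` N2 `|` C \in pi ++ cs \/
          (D = xbot X /\ tautological (N1 `|` N2 `|` C)) &
        2 * size cs <= 2 ^ m].
  move=> H; have [cs [lecs dcs mcs]] := @select_derivable _ F pi
    (fun C => N1 `|` N2 `|` C)
    (fun C => D = xbot X /\ tautological (N1 `|` N2 `|` C)) (enum_fset (cnf D)) H.
  exists cs; split.
  - exact: resolution_derivation_cat.
  - move=> C /mcs [Ccs|]; last by right.
    by left; rewrite mem_cat Ccs orbT.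
  - rewrite e2m leq_mul2l /=; apply: leq_trans lecs _.
    by apply: leq_trans (card_cnf D) _; rewrite leq_exp2l //; lia.
case: sub av1 av2 {Dm} D2m simple =>
  [x b S q xS|x y p S q nxy xS yS|x y p S q nxy xS yS] av1 av2 D2m simple.
- have [|cs [dcs mcs scs]] := simple; last first.
    by exists cs; split; [exact: dcs|exact: mcs|left].
  by move=> C CS; exact: derives_unit xS av1 av2 CS.
- have [|cs [dcs mcs scs]] := simple; last first.
    by exists cs; split; [exact: dcs|exact: mcs|left].
  by move=> C CS; left; exact: derives_fresh av1 av2 CS.
(* [R true] and [R false] carry the two signs of [y]; resolving them on [y] gives [R']. *)
pose R c := [seq (y, c) |` (N1 `|` N2 `|` C) | C <- cnf (S, q (+) p)].
pose R' := [seq N1 `|` N2 `|` C | C <- cnf (S, q (+) p)].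
exists ((R true ++ R false) ++ R'); split.
- rewrite catA; apply: resolution_derivation_cat.
    apply: resolution_derivation_cat => // A; rewrite mem_cat.
    by case/orP => /mapP [C CS ->]; exact: derives_shared av1 av2 CS.
  move=> A /mapP [C CS ->]; rewrite -[X in derives _ _ X]fsetUid.
  apply: (@derives_resolvent _ _ _ y true); rewrite !mem_cat.
    by rewrite [_ \in R true]map_f ?orbT.
  by rewrite [_ \in R false]map_f ?orbT.
- by move=> C CS; left; rewrite !mem_cat map_f ?orbT.
move: D2m; rewrite !size_cat !size_map /xarity /=.
have xyS : x \notin y |` S by rewrite !inE negb_or nxy.
rewrite cardfs2 !cardfsU1 xyS yS nxy => D2m.
have := card_cnf (S, q (+) p); rewrite /xarity /=.
case: (posnP #|` S|) => [S0|Spos].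
  (* With [S] empty there is at most one clause, the empty one. Its three steps fit into [2 ^ m.-1]
     as soon as [m] is at least 3. *)
  move: D2m => /=; rewrite (cardfs0_eq S0) cardfs0 cnf0.
  case: (q (+) p); last by left.
  rewrite cardfs1 => le2m _; case: (ltnP 2 m) => [lt2m|lem2]; last first.
    by right; split=> //; lia.
  by left; apply: leq_trans (_ : 2 ^ 3 <= _) => //; rewrite leq_exp2l.
move=> leC; left.
(* Three times [2 ^ (s - 1)] is at most [2 ^ (s + 1)], where [s] is the size of [S] and
   [s + 2 <= m]. *)
have : 2 ^ #|` S|.-1.+3 <= 2 ^ m by rewrite leq_exp2l //; move: Spos D2m; lia.
by rewrite !expnS; move: leC; move: (2 ^ _.-1) => u; lia.
Qed.

End Substitution.

(** * Explanations as sets of negated literals *)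

Section NegatedLiterals.
Variable X : choiceType.
Implicit Types (A B : {fset xorc X}) (lam : {fset literal X}).

(* Meaningful only when all constraints of A are unary, i.e. literals. *)
Definition nlits A : clause X :=
  \bigcup_(D <- A) [fset (x, ~~ xparity D) | x in xvars D].

Lemma in_nlits A x b :
  reflect (exists2 D, D \in A & x \in D.1 /\ b = ~~ D.2) ((x, b) \in nlits A).
Proof.
apply: (iffP (bigfcupP _ _ _ _)) => [[D /andP [DA _] /imfsetP [y yD [-> ->]]]|].
  by exists D.
move=> [D DA [xD ->]]; exists D; first by rewrite DA.
by apply/imfsetP; exists x.
Qed.

Lemma nlits0 : nlits fset0 = fset0.
Proof. by rewrite /nlits big_nil. Qed.

Lemma nlitsU A B : nlits (A `|` B) = nlits A `|` nlits B.
Proof.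
apply/fsetP => -[x b]; rewrite inE; apply/in_nlits/orP.
  by move=> [D]; rewrite inE => /orP [] ? ?; [left|right];
    apply/in_nlits; exists D.
by move=> [] /in_nlits [D DAB xD]; exists D; rewrite // inE DAB ?orbT.
Qed.

Lemma nlits_lits lam :
  nlits [fset lit_xor l | l in lam] = [fset neg l | l in lam].
Proof.
apply/fsetP => -[x b]; apply/in_nlits/imfsetP.
  move=> [D /imfsetP [[y c] ylam -> /=]]; rewrite inE => -[/eqP -> ->].
  by exists (y, c).
move=> [[y c] ylam [-> ->]]; exists (lit_xor (y, c)).
  by apply/imfsetP; exists (y, c).
by rewrite /= inE.
Qed.

Lemma nlits1 (l : literal X) : nlits [fset lit_xor l] = [fset neg l].
Proof.
have -> : [fset lit_xor l] = [fset lit_xor k | k in [fset l]].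
  by rewrite imfset_fset1.
by rewrite nlits_lits imfset_fset1.
Qed.

Lemma lit_xorP (D : xorc X) : reflect (exists l, D = lit_xor l) (xarity D == 1).
Proof.
case: D => S q; apply: (iffP idP) => [/cardfs1P [x /= ->]|[l ->]].
  by exists (x, q).
by rewrite /xarity /= cardfs1.
Qed.

End NegatedLiterals.

(** * Induction on acyclic graphs *)

Section Acyclic.
Variables (V : finType) (E : rel V).
Hypothesis acE : acyclic E.

Lemma card_ancestors u v :
  E u v -> #|[set w | connect E w u]| < #|[set w | connect E w v]|.
Proof.
move=> Euv; apply/proper_card/properP; split.
  apply/subsetP => x; rewrite !inE => xu.
  exact: connect_trans xu (connect1 Euv).
by exists v; rewrite inE ?connect0 // acE.
Qed.

Lemma acyclic_ind (P : V -> Prop) :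
  (forall v, (forall u, E u v -> P u) -> P v) -> forall v, P v.
Proof.
move=> H v; have [n] := ubnP #|[set w | connect E w v]|.
elim: n v => // n IH v; rewrite ltnS => le; apply: H => u /card_ancestors lt.
by apply: IH; apply: leq_trans lt le.
Qed.

(** Inserts the vertices in a topological order, which lets a quantity be summed over the vertices
    already processed. *)
Lemma acyclic_set_ind (P : {set V} -> Prop) :
  P set0 ->
  (forall (A : {set V}) v, v \notin A -> (forall u, E u v -> u \in A) ->
    P A -> P (v |: A)%SET) ->
  P setT.
Proof.
move=> P0 PS.
suff: forall n (A : {set V}), #|A| = n ->
    (forall u v, v \in A -> E u v -> u \in A) -> P A.
  by move=> /(_ _ setT erefl); apply => *; rewrite inE.
elim=> [|n IH] A cA clA; first by rewrite (cards0_eq cA).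
have [v0 v0A] : exists v, v \in A by apply/card_gt0P; rewrite cA.
(* A vertex of [A] with the most ancestors has no successor in [A], so removing it keeps the set
   closed under predecessors. *)
have [v vA0 vmax] :=
  @arg_maxnP _ v0 (mem A) (fun v => #|[set w | connect E w v]|) v0A.
have {vA0} vA : v \in A := vA0.
have nv u : u \in A -> ~~ E v u.
  move=> uA; apply/negP => /card_ancestors.
  by rewrite ltnNge => /negP; apply; apply: vmax.
rewrite -(setD1K vA); apply: PS.
- by rewrite !inE eqxx.
- move=> u Euv; rewrite !inE (clA u v) // andbT.
  by apply/eqP => euv; move: (nv v vA); rewrite -{1}euv Euv.
apply: IH => [|u w]; first by move: cA; rewrite (cardsD1 v) vA => -[].
rewrite !inE => /andP [_ wA] Euw; rewrite (clA u w) // andbT.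
by apply/eqP => euv; move: (nv w wA); rewrite -euv Euw.
Qed.

End Acyclic.

(** * Building the derivation along the graph *)

Section Derivation.
Variables (X : choiceType) (phi : seq (xorc X)) (ls : seq (literal X)).
Variables (V : finType) (E : rel V) (L : V -> xorc X) (Va : {set V}).
Hypothesis hG : subst_derivation E L (phi ++ map (@lit_xor X) ls).

Let m := \max_(D <- phi) xarity D.
Let F (C : clause X) := exists2 D, D \in phi & C \in cnf D.
Let ex := expl E L phi Va.
Let acE := sd_acyclic hG.

Lemma input_label v :
  is_input E v -> L v \notin phi -> exists l, L v = lit_xor l.
Proof.
move=> /(sd_input hG); rewrite mem_cat => /orP [->//|/mapP [l _ ->] _].
by exists l.
Qed.

Lemma sources v : ~~ is_input E v ->
  exists v1 v2, [/\ E v1 v, E v2 v, forall u, E u v -> u = v1 \/ u = v2,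
    v1 != v2 & subst_spec (L v1) (L v2) (L v)].
Proof.
move=> /(sd_rule hG) [v1 [v2 [n12 Ev sub]]]; exists v1, v2; split=> //.
- by rewrite Ev eqxx.
- by rewrite Ev eqxx orbT.
- by move=> u; rewrite Ev => /orP [] /eqP; [left|right].
- exact: subst_ruleP.
Qed.

(** A rule never yields more variables than its second premise has. The [1] accounts for the
    assumptions, which are unary even when [m = 0]. *)
Lemma xarity_label v : xarity (L v) <= maxn m 1.
Proof.
elim/(acyclic_ind acE): v => v IH.
have [inp|/sources [v1 [v2 [_ /IH le2 _ _ /xarity_subst le]]]] :=
  boolP (is_input E v).
  have [Lphi|/(input_label inp) [l ->]] := boolP (L v \in phi).
    by apply: leq_trans (leq_maxl _ _); apply: leq_bigmax_seq.
  by rewrite /xarity /= cardfs1 leq_maxr.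
exact: leq_trans le le2.
Qed.

Lemma expl_internal v : ~~ is_input E v -> v \notin Va ->
  exists v1 v2, [/\ E v1 v, E v2 v, forall u, E u v -> u = v1 \/ u = v2,
    subst_spec (L v1) (L v2) (L v) & ex v = ex v1 `|` ex v2].
Proof.
move=> nin nVa; have [v1 [v2 [E1 E2 E12 n12 sub]]] := sources nin.
exists v1, v2; split=> //; rewrite /ex explE // (negbTE nin) (negbTE nVa).
apply/fsetP => D; rewrite inE; apply/bigfcupP/orP.
  by move=> [u /andP [_ /E12 [->|->]] ?]; [left|right].
by move=> [D1|D2]; [exists v1|exists v2]; rewrite // mem_index_enum.
Qed.

Definition literal_expl v := all (fun D : xorc X => xarity D == 1) (ex v).

Lemma literal_explU v v1 v2 :
  ex v = ex v1 `|` ex v2 -> literal_expl v -> literal_expl v1 /\ literal_expl v2.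
Proof.
move=> e /allP H; split; apply/allP => D Dv; apply: H;
by rewrite -[_ \in _]/(D \in ex v) e inE Dv ?orbT.
Qed.

(* The vertices whose clauses have to be derived: the explanation of any other
   vertex is its own label, so that its clauses are tautologies. *)
Definition derived_vertex v :=
  if is_input E v then L v \in phi else v \notin Va.

Lemma expl_underived v : ~~ derived_vertex v -> ex v = [fset L v].
Proof.
rewrite /derived_vertex /ex explE //; case: ifP => [_ /negbTE -> //|_].
by rewrite negbK => ->.
Qed.

(** The exception is inherited from [derives_unit]: a contradiction whose explanation contains two
    opposite literals. *)
Definition covers (pi : seq (clause X)) v : Prop :=
  derived_vertex v -> literal_expl v -> forall C, C \in cnf (L v) ->
    nlits (ex v) `|` C \in pi \/
    (L v = xbot X /\ tautological (nlits (ex v) `|` C)).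

Lemma covers_available pi v :
  covers pi v -> literal_expl v -> 0 < xarity (L v) ->
  available pi (nlits (ex v)) (L v).
Proof.
move=> cov lit pos; have [dv|ndv] := boolP (derived_vertex v).
  left => C /(cov dv lit) [//|[Lbot _]].
  by rewrite Lbot /xarity cardfs0 in pos.
right; have e := expl_underived ndv.
have /lit_xorP [l el] : xarity (L v) == 1.
  by apply: (allP lit); rewrite e; exact: fset11.
by exists l; rewrite // e el nlits1.
Qed.

(* When m = 2, the sources of a vertex with a binary label have binary labels
   too: eliminating a variable by a unary constraint would take a ternary D. *)
Lemma expl_binary v D : m = 2 -> xarity (L v) = 2 -> D \in ex v -> xarity D = 2.
Proof.
move=> m2; elim/(acyclic_ind acE): v => v IH L2.
have [dv|/expl_underived ->] := boolP (derived_vertex v); last first.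
  by rewrite inE => /eqP ->.
have [inp|nin] := boolP (is_input E v).
  by rewrite /ex explE //; move: dv; rewrite /derived_vertex inp => ->.
move: dv; rewrite /derived_vertex (negbTE nin).
move=> /(expl_internal nin) [v1 [v2 [E1 E2 _ sub ->]]].
suff [L1 L2'] : xarity (L v1) = 2 /\ xarity (L v2) = 2.
  by rewrite inE => /orP []; apply: IH.
have := xarity_label v2; rewrite m2 => le2; move: le2 L2; rewrite /xarity.
case: sub => [x b S q xS|x y p S q nxy xS yS|x y p S q nxy xS yS] /=.
- by rewrite cardfsU1 xS; lia.
- by rewrite cardfs2 nxy !cardfsU1 xS yS; lia.
- by rewrite cardfs2 nxy !cardfsU1 yS !inE (negbTE nxy) (negbTE xS) /=; lia.
Qed.

Let flag := [exists v in (~: Va)%SET, binary_conflict E L v].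

Lemma derivation_exists : 0 < m ->
  exists pi,
    [/\ resolution_derivation F pi, forall v, covers pi v &
        2 * size pi <= #|V| * 2 ^ m + 2 * ((m == 2) && flag)].
Proof.
move=> m0.
(* The surplus clause is charged only once [fset0] is in [pi], so it is paid at most once although
   several vertices may be conflicts. *)
pose P (A : {set V}) := exists pi,
  [/\ resolution_derivation F pi, forall v, v \in A -> covers pi v &
      2 * size pi <= #|A| * 2 ^ m + 2 * ((m == 2) && flag && (fset0 \in pi))].
suff [pi [dpi cov le]] : P setT.
  exists pi; split=> //; first by move=> v; apply: cov; rewrite inE.
  apply: leq_trans le _; rewrite cardsT leq_add2l leq_mul2l /=.
  by case: (_ && flag); case: (fset0 \in pi).
have mono pi cs v : covers pi v -> covers (pi ++ cs) v.
  move=> cov dv lit C /(cov dv lit) [Cpi|]; last by right.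
  by left; rewrite mem_cat Cpi.
have mle v : xarity (L v) <= m by rewrite -(maxn_idPl m0) xarity_label.
apply: (@acyclic_set_ind V E acE P) => [|A v vA Ev [pi [dpi cov le]]].
  by exists [::]; split=> // v; rewrite inE.
suff [cs [dcs ccs lecs]] : exists cs,
    [/\ resolution_derivation F (pi ++ cs), covers (pi ++ cs) v &
        2 * size cs <= 2 ^ m \/
        [/\ m = 2, flag, fset0 \notin pi, fset0 \in pi ++ cs & size cs = 3]].
  exists (pi ++ cs); split=> //.
    by move=> u /setU1P [->//|/cov /mono]; apply.
  rewrite cardsU1 vA mulnDl mul1n size_cat mulnDr addnC -addnA.
  case: lecs => [lecs|[m2 fl f0 f1 ->]].
    apply: leq_add => //; apply: leq_trans le _; rewrite leq_add2l leq_mul2l.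
    rewrite mem_cat; case: (_ && flag) => //.
    by case: (fset0 \in pi).
  by move: le; rewrite m2 fl f1 (negbTE f0); lia.
have none : (derived_vertex v -> literal_expl v -> False) -> exists cs,
    [/\ resolution_derivation F (pi ++ cs), covers (pi ++ cs) v &
        2 * size cs <= 2 ^ m \/
        [/\ m = 2, flag, fset0 \notin pi, fset0 \in pi ++ cs & size cs = 3]].
  move=> H; exists [::]; rewrite cats0; split=> //; last by left.
  by move=> dv /(H dv).
have [dv|/negP ndv] := boolP (derived_vertex v); last by apply: none.
have [lit|/negP nlit] := boolP (literal_expl v); last by apply: none.
have [inp|nin] := boolP (is_input E v).
  exists (enum_fset (cnf (L v))).
  move: dv; rewrite /covers /derived_vertex inp => Lphi; split.
  - apply: resolution_derivation_cat => // C CL.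
    by apply: Or32; exists (L v).
  - move=> _ _ C CL; left; rewrite /ex explE // inp Lphi nlits0 fset0U.
    by rewrite mem_cat CL orbT.
  - left; rewrite -(prednK m0) expnS leq_mul2l /=.
    apply: leq_trans (card_cnf (L v)) _; rewrite leq_exp2l //.
    by have := mle v; lia.
have nVa : v \notin Va by move: dv; rewrite /derived_vertex (negbTE nin).
have [v1 [v2 [E1 E2 E12 sub e]]] := expl_internal nin nVa.
have [lit1 lit2] := literal_explU e lit.
have [pos1 pos2] := xarity_sources sub.
have av1 := covers_available (cov _ (Ev _ E1)) lit1 pos1.
have av2 := covers_available (cov _ (Ev _ E2)) lit2 pos2.
have [cs [dcs ccs lecs]] :=
  extend_derivation dpi av1 av2 sub m0 (mle v2).
have cov_cs : covers (pi ++ cs) v.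
  by move=> _ _ C CL; rewrite e nlitsU; apply: ccs.
case: lecs => [lecs|[m2 L1 L2 Lbot s3]]; first by exists cs; split=> //; left.
(* By [expl_binary] every conjunct of the explanation has two variables, by [lit] only one: there is
   none. *)
have ex0 : nlits (ex v) = fset0.
  apply/eqP; apply: contraT => /fset0Pn [[x b] /in_nlits [D Dv _]].
  have : xarity D == 1 by apply: (allP lit).
  move: Dv; rewrite e inE => /orP [] /expl_binary -> //.
have fcov pi' : fset0 \in pi' -> covers pi' v.
  move=> f0 _ _ C; rewrite ex0 Lbot cnf0 inE => /eqP ->; left.
  by rewrite fsetU0.
have [f0|nf0] := boolP (fset0 \in pi).
  exists [::]; rewrite cats0; split=> //; [exact: fcov | by left].
exists cs; split=> //; right; split=> //.
  apply/existsP; exists v; rewrite inE nVa /=.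
  apply/and3P; split=> //; first by rewrite Lbot.
  by apply/forallP => u; apply/implyP => /E12 [->|->]; rewrite ?L1 ?L2.
have [||] // := cov_cs dv lit fset0.
  by rewrite Lbot cnf0 inE.
  by rewrite ex0 fsetU0.
move=> [_ [l []]]; by rewrite ex0 fsetU0 inE.
Qed.

Lemma xarity_internal0 v : m = 0 -> ~~ is_input E v -> xarity (L v) = 0.
Proof.
move=> m0 /sources [v1 [v2 [_ _ _ _ sub]]].
have := (xarity_label v1, xarity_label v2); rewrite m0 /xarity.
case: sub => [x b S q xS|x y p S q nxy _ _|x y p S q nxy _ _] /= [] le1.
- by rewrite cardfsU1 xS; lia.
- by rewrite cardfs2 nxy in le1.
- by rewrite cardfs2 nxy in le1.
Qed.

Lemma derived_xarity0 v : m = 0 -> derived_vertex v -> xarity (L v) = 0.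
Proof.
rewrite /derived_vertex => m0; case: ifP => [_ Lphi|/negbT nin _].
  by apply/eqP; rewrite -leqn0 -m0; apply: leq_bigmax_seq.
exact: xarity_internal0.
Qed.

(** Every constraint of [phi] is now [xtop] or [xbot], so the empty clause alone suffices. The
    doubled bound is [#|V|], and two vertices pay for it. *)
Lemma derivation_exists0 : m = 0 -> 1 < #|V| ->
  exists pi,
    [/\ resolution_derivation F pi, forall v, covers pi v &
        2 * size pi <= #|V| * 2 ^ m + 2 * ((m == 2) && flag)].
Proof.
move=> m0 V2; exists (if xbot X \in phi then [:: fset0] else [::]); split.
- case: ifP => // botphi [|i] // _; left; exists (xbot X) => //.
  by rewrite cnf0 inE.
- move=> v dv lit C; have := derived_xarity0 m0 dv.
  have [inp|nin] := boolP (is_input E v).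
    move: dv; rewrite /derived_vertex inp /ex explE // inp => Lphi.
    rewrite Lphi nlits0 fset0U; case: (L v) Lphi => S q /[swap] /cardfs0_eq /= ->.
    by rewrite cnf0; case: q => // ->; rewrite inE => /eqP ->; left.
  move=> _; have nVa : v \notin Va.
    by move: dv; rewrite /derived_vertex (negbTE nin).
  have [v1 [v2 [_ _ _ sub e]]] := expl_internal nin nVa.
  have [lit1 lit2] := literal_explU e lit.
  have [pos1 pos2] := xarity_sources sub.
  (* Derived vertices have no variables, so both sources are implicit. With no clause at hand,
     [derives_unit] can only return its exception. *)
  have av u : literal_expl u -> 0 < xarity (L u) ->
      available [::] (nlits (ex u)) (L u).
    move=> litu posu; apply: covers_available => // du.
    by rewrite derived_xarity0 in posu.
  have := (av _ lit1 pos1, av _ lit2 pos2, xarity_label v1).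
  rewrite m0 /xarity e nlitsU.
  case: sub => [x b S q xS|x y p S q nxy _ _|x y p S q nxy _ _]
    /= [] [] av1 av2.
  + move=> _ /(derives_unit (fun=> False) xS av1 av2) [[]//|]; last by right.
    by move=> [P [Q []]].
  + by rewrite cardfs2 nxy.
  + by rewrite cardfs2 nxy.
- apply: leq_trans (leq_addr _ _); rewrite m0 expn0 muln1.
  by case: ifP.
Qed.

End Derivation.

(** The size bound is doubled to avoid the exponent [m - 1] at [m = 0]; its last term allows one
    more clause for a binary conflict. The exempted tautologies cannot always be produced by
    resolution, as for an assumption on a variable foreign to [phi]. *)
Theorem theorem2 (X : choiceType) (phi : seq (xorc X)) (ls : seq (literal X))
    (V : finType) (E : rel V) (L : V -> xorc X)
    (hG : subst_derivation E L (phi ++ map (@lit_xor X) ls))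
    (Va Vb : {set V})
    (hcut : exists v : V, ~~ is_input E v /\ is_cut E v Va Vb)
    (hcnf : cnf_compatible E L phi Va Vb) :
  let m := \max_(D <- phi) xarity D in
  exists pi : seq (clause X),
    [/\ resolution_derivation
          (fun C => exists2 D, D \in phi & C \in cnf D) pi,
        (forall v : V, v \in Vb -> L v <> xtop X ->
         forall lam : {fset literal X},
           expl E L phi Va v = [fset lit_xor l | l in lam]%fset ->
         forall C : clause X, C \in cnf (L v) ->
           ~ (tautological (implies_clause lam C)
              /\ (is_input E v \/ L v = xbot X)) ->
           implies_clause lam C \in pi) &
        2 * size pi <=
          #|V| * 2 ^ m
          + 2 * ((m == 2) && [exists v in Vb, binary_conflict E L v])].
Proof.
move=> m; have [v0 [nin0 [eVb _ _]]] := hcut; subst Vb.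
have acE := sd_acyclic hG.
(* The two sources of a rule are distinct; the case [m = 0] relies on this. *)
have V2 : 1 < #|V|.
  have [v1 [v2 [_ _ _ n12 _]]] := sources hG nin0.
  by apply: leq_trans (max_card [set v1; v2]); rewrite cards2 n12.
have [pi [dpi cov le]] : exists pi,
    [/\ resolution_derivation (fun C => exists2 D, D \in phi & C \in cnf D) pi,
        forall v, covers phi E L Va pi v &
        2 * size pi <= #|V| * 2 ^ m + 2 *
          ((m == 2) && [exists v in (~: Va)%SET, binary_conflict E L v])].
  case: (posnP m) => [m0|mpos]; first exact: (derivation_exists0 Va hG m0 V2).
  exact: (derivation_exists Va hG mpos).
exists pi; split=> // v; rewrite inE => nVa _ lam elam C CL ntaut.
have impl : implies_clause lam C = nlits (expl E L phi Va v) `|` C.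
  by rewrite elam nlits_lits.
have lit : literal_expl phi E L Va v.
  by apply/allP => D; rewrite elam => /imfsetP [l _ ->]; apply/lit_xorP; exists l.
have [dv|ndv] := boolP (derived_vertex phi E L Va v).
  rewrite impl; have [//|[Lbot taut]] := cov v dv lit C CL.
  by case: ntaut; rewrite impl; split=> //; right.
(* Outside [Va], an underived vertex is an assumption, and its clause is an exempted tautology. *)
move: ndv (expl_underived hG ndv); rewrite /derived_vertex; case: ifP => inp.
  move=> Lphi e; case: ntaut; split; last by left.
  have [l el] := input_label hG inp Lphi.
  move: CL; rewrite impl e el nlits1 cnf1 -surjective_pairing inE => /eqP ->.
  exists l; rewrite !inE !eqxx orbT; split=> //.
by rewrite nVa.
Qed.
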